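(* Let $q$ be a prime power, $P \in \mathbb{F}_q[x]$ an irreducible polynomial, $k \geq 1$, and $D \subset \mathrm{Div}(P^k)$ with $P^k \notin D$. Then $G_{P^k}(D)$ is a perfect graph.
   Context: For a nonconstant $f \in \mathbb{F}_q[x]$, $\mathrm{Div}(f)$ is the set of divisors of $f$ up to multiplication by nonzero constants; for $D \subset \mathrm{Div}(f)$ with $f \notin D$, the gcd-graph $G_f(D)$ is the simple undirected graph with vertex set $\mathbb{F}_q[x]/f$ in which $a,b$ are adjacent iff $\gcd(a-b,f) \in D$ (gcd taken up to nonzero constants). A graph is perfect if for every induced subgraph the clique number equals the chromatic number. *)

(* Defs.v *)
From HB Require Import structures.
From mathcomp Require Import all_boot all_order all_algebra.

Set Implicit Arguments.
Unset Strict Implicit.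
Unset Printing Implicit Defensive.

Import GRing.Theory.
Local Open Scope ring_scope.
Local Open Scope quotient_scope.

Record sgraph := SGraph {
  vertex :> finType;
  edge : rel vertex;
  edge_sym : symmetric edge;
  edge_irrefl : irreflexive edge }.

Section Graphs.
Variable G : sgraph.

Definition clique (C : {set G}) : bool :=
  [forall x in C, forall y in C, (x != y) ==> edge x y].

Definition clique_number : nat := (\max_(C : {set G} | clique C) #|C|)%N.

Definition proper_coloring k (c : {ffun G -> 'I_k}) : bool :=
  [forall x : G, forall y : G, edge x y ==> (c x != c y)].

Definition colorable k : bool :=
  [exists c : {ffun G -> 'I_k}, proper_coloring c].

Fact colorable_ex : exists k, colorable k.
Proof.
exists #|G|; apply/existsP; exists [ffun x => enum_rank x].
apply/forallP=> x; apply/forallP=> y; apply/implyP=> xy.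
rewrite !ffunE (inj_eq enum_rank_inj).
by apply: contraTneq xy => ->; rewrite edge_irrefl.
Qed.

Definition chromatic_number : nat := ex_minn colorable_ex.

Section Induced.
Variable S : {set G}.

Definition induced_edge : rel {x : G | x \in S} :=
  fun x y => edge (val x) (val y).

Fact induced_sym : symmetric induced_edge.
Proof. by move=> x y; exact: edge_sym. Qed.

Fact induced_irrefl : irreflexive induced_edge.
Proof. by move=> x; exact: edge_irrefl. Qed.

Definition induced : sgraph := SGraph induced_sym induced_irrefl.
End Induced.
End Graphs.

Definition perfect (G : sgraph) : Prop :=
  forall S : {set G}, clique_number (induced S) = chromatic_number (induced S).

Section Div.
Variables (F : finFieldType) (f : {poly F}).

Definition divisor := {g : {poly F} | g %| f}.

Definition assoc_divisor : rel divisor := fun g h => val g %= val h.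

Fact assoc_divisor_equiv : equiv_class_of assoc_divisor.
Proof.
split=> [g | g h | h g l gh hl]; rewrite /assoc_divisor ?eqpxx //.
- exact: eqp_sym.
- exact: eqp_trans gh hl.
Qed.

Canonical assoc_divisor_equiv_rel := EquivRelPack assoc_divisor_equiv.

Definition Div := {eq_quot assoc_divisor}.

Definition div_class (g : {poly F}) (gf : g %| f) : Div :=
  \pi_Div (exist (fun g => is_true (g %| f)) g gf).

Definition gcd_class (g : {poly F}) : Div := div_class (dvdp_gcdr g f).

Definition self_class : Div := div_class (dvdpp f).

Fact gcd_class0 : gcd_class 0 = self_class.
Proof. by apply/eqmodP; rewrite /= /assoc_divisor /= gcd0p eqpxx. Qed.

Fact gcd_classN (g : {poly F}) : gcd_class (- g) = gcd_class g.
Proof.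
apply/eqmodP; rewrite /= /assoc_divisor /=; apply: eqp_gcdl.
by rewrite -scaleN1r eqp_scale // oppr_eq0 oner_eq0.
Qed.
End Div.

(* The library's quotient {poly %/ h} is F[x]/(h) only for h monic and
   nonconstant (otherwise h is silently replaced by 'X), while f need not be
   monic here; f and its monic associate generate the same ideal. *)
Definition quot (F : finFieldType) (f : {poly F}) :=
  {poly %/ (lead_coef f)^-1 *: f}.

Section GcdGraph.
Variables (F : finFieldType) (f : {poly F}) (D : {pred Div f}).
Hypothesis fD : self_class f \notin D.

Definition gcd_edge : rel (quot f) :=
  fun a b => gcd_class f (a - b : quot f) \in D.

Fact gcd_edge_sym : symmetric gcd_edge.
Proof.
by move=> a b; rewrite /gcd_edge -[in LHS]opprB -(gcd_classN f (b - a : quot f)).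
Qed.

Fact gcd_edge_irrefl : irreflexive gcd_edge.
Proof. by move=> a; rewrite /gcd_edge subrr gcd_class0 (negbTE fD). Qed.

Definition gcd_graph : sgraph := SGraph gcd_edge_sym gcd_edge_irrefl.
End GcdGraph.

(* Main.v *)
(* The vertices form an ultrametric space for the P-adic valuation of a - b,
   and adjacency depends only on that valuation. Take a minimal valuation i
   attained in a set S of vertices, at a pair (x, y). The closed ball
   A = {z : v(x, z) > i} and S \ A are then joined completely or not at all,
   according to whether P^i is in D. Induction on |S| therefore gives a clique
   and a proper coloring of the same size: both sizes add up in the first case,
   and both are maxima in the second. *)
Require Import Defs.
From mathcomp Require Import all_boot all_order all_algebra.
Local Open Scope ring_scope.

Import GRing.Theory.

Set Implicit Arguments.
Unset Strict Implicit.
Unset Printing Implicit Defensive.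

(** * Cliques and proper colorings of equal size *)

Section CliqueColoring.
Variable G : sgraph.
Implicit Types (x y : G) (A B C S : {set G}).

Lemma cliqueP C :
  reflect {in C &, forall x y, x != y -> edge x y} (clique C).
Proof.
apply: (iffP forall_inP) => [h x y xC yC | h x xC].
  by move: (h x xC) => /forall_inP/(_ y yC)/implyP.
by apply/forall_inP => y yC; apply/implyP; apply: h.
Qed.

Lemma clique_leq_coloring C k (c : {ffun G -> 'I_k}) :
  clique C -> proper_coloring c -> (#|C| <= k)%N.
Proof.
move=> /cliqueP cC /forallP pc.
have /card_in_imset <- : {in C &, injective c}.
  move=> x y xC yC /eqP cxy; apply/eqP; apply: contraTT cxy => xy.
  by move: (pc x) => /forallP/(_ y)/implyP; apply; apply: cC.
by rewrite -[leqRHS]card_ord max_card.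
Qed.

(** Certificate of equality of the two numbers on [S]. The coloring is total with values in [nat]
    and constrained only on [S], so that certificates for two pieces can be glued inside [G]
    itself. *)
Definition clique_coloring S C (c : G -> nat) :=
  [/\ C \subset S, clique C, {in S, forall x, (c x < #|C|)%N}
    & {in S &, forall x y, edge x y -> c x != c y}].

(** A proper coloring is injective on cliques, so no clique outnumbers the colors; the certificate
    squeezes both numbers to [#|C|]. *)
Lemma clique_coloring_eq C c :
  clique_coloring setT C c -> clique_number G = chromatic_number G.
Proof.
move=> [_ cC cltn cpr]; apply/eqP; rewrite eqn_leq; apply/andP; split.
  rewrite /chromatic_number; case: ex_minnP => k /existsP[c' c'P] _.
  by apply/bigmax_leqP => C' cC'; apply: clique_leq_coloring c'P.
rewrite /chromatic_number; case: ex_minnP => k _ kmin.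
apply: (@leq_trans #|C|); last exact: leq_bigmax_cond.
apply: kmin; apply/existsP.
exists [ffun x => Ordinal (cltn x (in_setT x))].
apply/forallP => x; apply/forallP => y; apply/implyP => xy.
by rewrite !ffunE -val_eqE /= cpr ?inE.
Qed.

(** Shifting the colors of [B] by [#|CA|] makes the two palettes disjoint, as the edges across
    require. *)
Lemma clique_coloring_join A B CA CB cA cB :
  [disjoint A & B] -> {in A & B, forall x y, edge x y} ->
  clique_coloring A CA cA -> clique_coloring B CB cB ->
  clique_coloring (A :|: B) (CA :|: CB)
    (fun x => if x \in A then cA x else #|CA| + cB x)%N.
Proof.
move=> dAB eAB [sA /cliqueP qA ltA prA] [sB /cliqueP qB ltB prB].
have cardC : #|CA :|: CB| = (#|CA| + #|CB|)%N.
  by rewrite cardsU disjoint_setI0 ?cards0 ?subn0 // (disjointW sA sB).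
split; first exact: setUSS.
- apply/cliqueP => x y; rewrite !inE.
  move=> /orP[] xC /orP[] yC xy; [exact: qA | | | exact: qB].
    by apply: eAB; [apply: (subsetP sA) | apply: (subsetP sB)].
  by rewrite edge_sym eAB //; [apply: (subsetP sA) | apply: (subsetP sB)].
- move=> x; rewrite inE cardC; case: ifP => [xA _ | _ /= xB].
    by apply: leq_trans (leq_addr _ _); apply: ltA.
  by rewrite ltn_add2l ltB.
- move=> x y; rewrite !inE.
  case: ifP => [xA _ | _ /= xB]; case: ifP => [yA _ | _ /= yB] exy.
  + exact: prA.
  + by rewrite neq_ltn (leq_trans (ltA _ xA)) ?leq_addr.
  + by rewrite neq_ltn orbC (leq_trans (ltA _ yA)) ?leq_addr.
  + by rewrite eqn_add2l prB.
Qed.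

(** With no edge across, both pieces can share one palette, and the larger clique matches its
    size. *)
Lemma clique_coloring_union A B CA CB cA cB :
  {in A & B, forall x y, ~~ edge x y} ->
  clique_coloring A CA cA -> clique_coloring B CB cB ->
  clique_coloring (A :|: B) (if #|CA| <= #|CB| then CB else CA)%N
    (fun x => if x \in A then cA x else cB x).
Proof.
move=> eAB [sA qA ltA prA] [sB qB ltB prB].
split.
- by case: ifP => _; [apply: subset_trans sB _ | apply: subset_trans sA _];
    rewrite ?subsetUl ?subsetUr.
- by case: ifP.
- move=> x; rewrite inE.
  have -> : #|pred_of_set (if #|CA| <= #|CB| then CB else CA)%N|
      = maxn #|CA| #|CB| by case: leqP.
  rewrite leq_max; case: ifP => [xA _ | _ /= xB]; first by rewrite ltA.
  by rewrite ltB ?orbT.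
- move=> x y; rewrite !inE.
  case: ifP => [xA _ | _ /= xB]; case: ifP => [yA _ | _ /= yB] exy.
  + exact: prA.
  + by have := eAB x y xA yB; rewrite exy.
  + by have := eAB y x yA xB; rewrite edge_sym exy.
  + exact: prB.
Qed.

End CliqueColoring.

(** * Graphs whose adjacency depends on an ultrametric valuation *)

Lemma ultrametric_clique_coloring (G : sgraph) (v : G -> G -> nat)
    (d : pred nat) (S : {set G}) :
  (forall x y z, (minn (v x y) (v y z) <= v x z)%N) ->
  (forall x y, x != y -> edge x y = d (v x y)) ->
  exists C c, clique_coloring S C c.
Proof.
move=> ultra edgeE; have [n] := ubnP #|S|; elim: n S => // n IH S leSn.
have [S1 | /card_gt1P[x0 [y0 [x0S y0S xy0]]]] := leqP #|S| 1.
  exists S, (fun=> 0%N).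
  have eqS : {in S &, forall x y, x = y}.
    by move=> x y xS yS; apply: (card_le1_eqP S1).
  split=> // [|x xS|x y xS yS]; last by rewrite (eqS x y) ?edge_irrefl.
    by apply/cliqueP => x y xS yS /eqP[]; apply: eqS.
  by rewrite card_gt0; apply/set0Pn; exists x.
pose pairS (p : G * G) := [&& p.1 \in S, p.2 \in S & p.1 != p.2].
have pair0 : pairS (x0, y0) by rewrite /pairS /= x0S y0S.
case: (arg_minnP (fun p : G * G => v p.1 p.2) pair0).
move=> [x y] /and3P[/= xS yS xy] vmin.
have vge a b : a \in S -> b \in S -> a != b -> (v x y <= v a b)%N.
  by move=> aS bS ab; apply: (vmin (a, b)); rewrite /pairS /= aS bS.
(* The point [x] is added by hand, since [v x x] may equal [v x y]. *)
pose A := [set z in S | (z == x) || (v x y < v x z)%N].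
pose B := S :\: A.
have defS : S = A :|: B.
  rewrite -(setID S A) (setIidPr _) //.
  by apply/subsetP => z; rewrite inE => /andP[].
have crossE : {in A & B, forall a b, edge a b = d (v x y)}.
  move=> a b; rewrite !inE => /andP[aS xa] /andP[bA bS].
  move: bA; rewrite bS negb_or -leqNgt => /andP[bx xb].
  have ab : a != b.
    by apply: contraTneq xa => ->; rewrite negb_or bx -leqNgt.
  (* Minimality gives [v x y <= v a b]. Conversely, for [a != x], the minimum of [v x a] and [v a b]
     is at most [v x b <= v x y], and [v x a] exceeds [v x y]. *)
  rewrite edgeE //; congr (d _); apply/eqP; rewrite eqn_leq vge // andbT.
  case/predU1P: xa => [-> // | xa].
  by move: (leq_trans (ultra x a b) xb); rewrite geq_min leqNgt xa.
have xA : x \in A by rewrite inE xS eqxx.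
have yB : y \in B by rewrite !inE yS ltnn orbF eq_sym xy.
have ltAS : (#|A| < #|S|)%N.
  rewrite defS; apply: proper_card; apply/properP; split; first exact: subsetUl.
  by exists y; [rewrite in_setU yB orbT | case/setDP: yB].
have ltBS : (#|B| < #|S|)%N.
  rewrite defS; apply: proper_card; apply/properP; split; first exact: subsetUr.
  by exists x; [rewrite in_setU xA | rewrite in_setD xA].
have [CA [cA hA]] := IH A (leq_trans ltAS leSn).
have [CB [cB hB]] := IH B (leq_trans ltBS leSn).
rewrite {1}defS; case: (boolP (d (v x y))) => dxy.
  do 2![eexists]; apply: clique_coloring_join hA hB.
    by rewrite -setI_eq0 setIDA setIC -setIDA setDv setI0.
  by move=> a b aA bB; rewrite crossE.
do 2![eexists]; apply: clique_coloring_union hA hB.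
by move=> a b aA bB; rewrite crossE.
Qed.

(** Both hypotheses restrict to induced subgraphs, so each of these has a certificate on its full
    vertex set. *)
Lemma ultrametric_perfect (G : sgraph) (v : G -> G -> nat) (d : pred nat) :
  (forall x y z, (minn (v x y) (v y z) <= v x z)%N) ->
  (forall x y, x != y -> edge x y = d (v x y)) ->
  perfect G.
Proof.
move=> ultra edgeE S.
have [||C [c Cc]] := @ultrametric_clique_coloring (induced S)
  (fun x y => v (val x) (val y)) d setT.
- by move=> x y z; apply: ultra.
- by move=> x y xy; apply: edgeE.
- exact: clique_coloring_eq Cc.
Qed.

(** * The P-adic valuation truncated at [k] *)

Section TruncatedValuation.
Variables (F : fieldType) (P : {poly F}) (k : nat).

(** Capping at [k] gives 0 the finite value [k]. *)
Definition trunc_val (g : {poly F}) : nat :=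
  \max_(j < k.+1 | P ^+ j %| g) j.

Lemma trunc_val_max j g : (j <= k)%N -> P ^+ j %| g -> (j <= trunc_val g)%N.
Proof.
by rewrite -ltnS => jk Pg; apply: (@leq_bigmax_cond _ _ _ (Ordinal jk)).
Qed.

Lemma trunc_val_leq g : (trunc_val g <= k)%N.
Proof. by apply/bigmax_leqP => j _; rewrite -ltnS. Qed.

Lemma trunc_val_dvd g : P ^+ trunc_val g %| g.
Proof.
rewrite /trunc_val; apply: (big_ind (fun m => P ^+ m %| g)) => //.
  by rewrite expr0 dvd1p.
by move=> m n Pm Pn; rewrite /maxn; case: ifP.
Qed.

Lemma trunc_valD g h :
  (minn (trunc_val g) (trunc_val h) <= trunc_val (g + h))%N.
Proof.
apply: trunc_val_max; first by rewrite geq_min trunc_val_leq.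
by apply: dvdp_add; apply: dvdp_trans (trunc_val_dvd _); apply: dvdp_exp2l;
  rewrite (geq_minl, geq_minr).
Qed.

(** If the valuation is [k], both sides are associate to [P ^+ k]. Otherwise the cofactor of
    [P ^+ trunc_val g] in [g] is coprime to [P] and drops out of the gcd. *)
Lemma gcdp_trunc_val g :
  irreducible_poly P -> gcdp g (P ^+ k) %= gcdp (P ^+ trunc_val g) (P ^+ k).
Proof.
move=> Pirr; have := trunc_val_leq g; rewrite leq_eqVlt => /predU1P[vk | vk].
  rewrite vk; apply: (@eqp_trans _ (P ^+ k)).
    by apply/dvdp_gcd_idr; rewrite -{1}vk trunc_val_dvd.
  by rewrite eqp_sym; apply/dvdp_gcd_idr.
have /dvdpP[h gE] := trunc_val_dvd g.
have Ph : coprimep (P ^+ k) h.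
  apply: coprimep_expl; rewrite irreducible_poly_coprime //.
  (* If [P] divided [h], the next power of [P], still within the cap by [vk], would divide [g]. *)
  apply/negP => Ph; have := @trunc_val_max (trunc_val g).+1 g vk.
  by rewrite ltnn {2}gE exprS dvdp_mul // => /(_ isT).
rewrite {1}gE; apply: eqp_trans (gcdpC _ _) _.
by apply: eqp_trans (Gauss_gcdpr _ Ph) (gcdpC _ _).
Qed.

End TruncatedValuation.

Theorem corollary3p6 (F : finFieldType) (P : {poly F}) (k : nat)
    (D : {pred Div (P ^+ k)}) (Pirr : irreducible_poly P) (k_ge1 : (1 <= k)%N)
    (PkD : self_class (P ^+ k) \notin D) :
  perfect (gcd_graph PkD).
Proof.
apply: (@ultrametric_perfect (gcd_graph PkD)
  (fun a b => trunc_val P k ((a : quot (P ^+ k)) - b : quot (P ^+ k)))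
  (fun j => gcd_class (P ^+ k) (P ^+ j) \in D)) => [x y z | x y _].
  (* Addition in the quotient is addition of reduced representatives, so the polynomial inequality
     applies directly. *)
  rewrite -[(x : quot _) - z](subrKA (y : quot _)); exact: trunc_valD.
rewrite /= /gcd_edge; congr (_ \in D).
by apply/eqmodP; apply: gcdp_trunc_val.
Qed.
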